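(* Let $n\ge 2$ and let $G_1,\dots,G_n$ be finite groups, with $L_i$ denoting the nilpotent residual of $G_i$. Then $G_1\times G_2\times\cdots\times G_n$ is a solvable BT-group if and only if $G_i$ is a solvable BT-group for all $1\le i\le n$ and $(|L_i|,|G_j|)=1$ for all $1\le i,j\le n$ with $i\ne j$.
   Context: All groups are finite. Two subgroups $A,B$ of a group permute if $AB=BA$. A subgroup $H$ of $G$ is semipermutable in $G$ if $H$ permutes with every subgroup $X$ of $G$ such that $(|H|,|X|)=1$. $G$ is a BT-group if semipermutability is transitive: whenever $H\le K\le G$, $H$ is semipermutable in $K$ and $K$ is semipermutable in $G$, then $H$ is semipermutable in $G$. The nilpotent residual of $G$ is the intersection of all normal subgroups $N$ of $G$ such that $G/N$ is nilpotent. *)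

(* Defs.v *)
From HB Require Import structures.
From mathcomp Require Import all_boot all_fingroup all_solvable.

Set Implicit Arguments.
Unset Strict Implicit.
Unset Printing Implicit Defensive.

Import GroupScope.

Section SemipermutableDefs.

Variable gT : finGroupType.
Implicit Types A B : {set gT}.

(* As with [normal], the inclusion of A in B is part of the notion. *)
Definition semipermutable A B :=
  (A \subset B) &&
  [forall (X : {group gT} | X \subset B),
     coprime #|A| #|X| ==> (A * X == X * A)].

Definition BT_group B :=
  [forall H : {group gT}, forall K : {group gT},
     [&& H \subset K, K \subset B, semipermutable H K & semipermutable K B]
       ==> semipermutable H B].

Definition nilpotent_residual B : {set gT} :=
  \bigcap_(N : {group gT} | (N <| B) && nilpotent (B / N)) N.

End SemipermutableDefs.

Arguments semipermutable {gT} A%_g B%_g.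
Arguments BT_group {gT} B%_g.
Arguments nilpotent_residual {gT} B%_g.

(* Main.v *)
Require Import Defs.
From HB Require Import structures.
From mathcomp Require Import all_boot all_fingroup all_solvable.

Set Implicit Arguments.
Unset Strict Implicit.
Unset Printing Implicit Defensive.

Import GroupScope.

(** Call a group coprime-permuting when any two of its subgroups of coprime
    orders permute. The proof replaces the BT property by this one, which,
    unlike the BT property, visibly passes to subgroups.

    For a solvable group the two properties agree. A coprime-permuting group is
    BT since all its subgroups are semipermutable. Conversely, let M be a normal
    subgroup of prime index in a solvable BT-group G. By induction M is
    coprime-permuting, so each subgroup of M is semipermutable in M, hence in G
    as M is normal. Of two subgroups of coprime orders one has order prime to
    |G : M|; it lies in M, is thus semipermutable in G, and permutes with the
    other ([sol_BT_coprime_permuting]).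

    Suppose the factors are coprime-permuting and satisfy the coprimality
    condition. It is enough to permute the cyclic groups generated by elements
    u and v of prime power and coprime orders. If all components commute there
    is nothing to do. If u_i and v_i do not commute, let L_i be the nilpotent
    residual of G_i. Since L_i controls which of two permuting subgroups
    normalises the other ([residual_coprime_norm]), |L_i| cannot be prime to
    both orders; and when |L_i| is not prime to the order of u_i, the
    coprimality condition forces u to be supported on the coordinate i, and
    likewise for v. In each case the claim reduces to what happens in G_i.

    Suppose conversely that the product is coprime-permuting, and that a prime p
    divides |L_i| and |G_j| with i != j. As p divides |L_i|, [residual_p'group]
    gives a p-element x and a p'-element y of G_i that normalises <[x]> without
    centralising it. Let z in G_j have order p, and
    take u = x z and v = y in the product. As <[u]> and <[v]> permute,
    v u = u^a v^b for some a and b. The coordinate j gives a = 1 mod p, and the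
    coordinate i then says that y acts trivially on <[x]> modulo its Frattini
    subgroup. By coprime action y centralises x, a contradiction. *)

(** * Semipermutability and permuting subgroups of coprime orders *)

(** Any two subgroups of G of coprime orders permute; equivalently, every
    subgroup of G is semipermutable in G. *)
Definition coprime_permuting (gT : finGroupType) (G : {set gT}) : Prop :=
  forall H X : {group gT}, H \subset G -> X \subset G ->
  coprime #|H| #|X| -> H * X = X * H.

Section OneGroup.

Variable gT : finGroupType.
Implicit Types G H K L M N P Q X : {group gT}.

Lemma semipermutableP H G :
  reflect (H \subset G /\
           forall X, X \subset G -> coprime #|H| #|X| -> H * X = X * H)
          (semipermutable H G).
Proof.
apply: (iffP andP) => [] [sHG permH]; split=> //.
  move=> X sXG coHX; apply/eqP.
  by have/forall_inP/(_ X sXG) := permH; rewrite coHX.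
by apply/forall_inP=> X sXG; apply/implyP=> coHX; rewrite permH.
Qed.

Lemma semipermutableS H K G :
  H \subset K -> K \subset G -> semipermutable H G -> semipermutable H K.
Proof.
move=> sHK sKG /semipermutableP[_ permH]; apply/semipermutableP; split=> //.
by move=> X sXK; apply/permH/(subset_trans sXK).
Qed.

Lemma normal_semipermutable M G : M <| G -> semipermutable M G.
Proof.
case/andP=> sMG nMG; apply/semipermutableP; split=> // X sXG _.
exact/esym/normC/(subset_trans sXG).
Qed.

Lemma BT_groupP G :
  reflect (forall H K, H \subset K -> K \subset G ->
             semipermutable H K -> semipermutable K G -> semipermutable H G)
          (BT_group G).
Proof.
apply: (iffP forallP) => [btG H K sHK sKG pHK pKG | btG H].
  by have/forallP/(_ K)/implyP := btG H; apply; apply/and4P.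
by apply/forallP=> K; apply/implyP=> /and4P[]; apply: btG.
Qed.

Lemma normal_BT M G : M <| G -> BT_group G -> BT_group M.
Proof.
move=> nsMG /BT_groupP btG; have sMG := normal_sub nsMG.
apply/BT_groupP=> H K sHK sKM pHK pKM.
have sKG := subset_trans sKM sMG.
apply: (semipermutableS (subset_trans sHK sKM) sMG).
apply: (btG H K) => //; apply: (btG K M) => //; exact: normal_semipermutable.
Qed.

Lemma coprime_permuting_BT G : coprime_permuting G -> BT_group G.
Proof.
move=> cpG; apply/BT_groupP=> H K sHK sKG _ _.
have sHG := subset_trans sHK sKG.
by apply/semipermutableP; split=> // X; apply: cpG.
Qed.

(** The converse of the previous lemma, for solvable groups. *)
Lemma sol_BT_coprime_permuting G :
  solvable G -> BT_group G -> coprime_permuting G.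
Proof.
have [n] := ubnP #|G|; elim: n G => // n IHn G leGn solG btG H X sHG sXG coHX.
have [G1 | ntG] := eqVneq (G : {set gT}) 1.
  by move: sHG sXG; rewrite G1 => /trivgP-> /trivgP->.
have [M nsMG prM] := sol_prime_factor_exists solG ntG.
have sMG := normal_sub nsMG.
have ltMG: #|M| < #|G|.
  by rewrite -(Lagrange sMG) ltn_Pmulr ?cardG_gt0 ?prime_gt1.
have cpM: coprime_permuting M.
  apply: IHn; first exact: leq_trans ltMG leGn.
    exact: solvableS solG.
  exact: normal_BT btG.
have semi_in_M (Y : {group gT}) : Y \subset M -> semipermutable Y G.
  move=> sYM; apply: (BT_groupP _ btG Y M) => //.
    by apply/semipermutableP; split=> // Z; apply: cpM.
  exact: normal_semipermutable.
have sub_M (Y : {group gT}) :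
  Y \subset G -> coprime #|Y| #|G : M| -> Y \subset M.
- move=> sYG coY; have nMY := subset_trans sYG (normal_norm nsMG).
  rewrite -quotient_sub1 //; apply/trivgP.
  apply: card1_trivg; apply/eqP; rewrite -dvdn1.
  rewrite -(eqP coY) dvdn_gcd dvdn_quotient /= -card_quotient ?normal_norm //.
  exact/cardSg/quotientS.
have [pdH | p'H] := boolP (#|G : M| %| #|H|).
  have /sub_M-/(_ sXG) sXM: coprime #|X| #|G : M|.
    by rewrite coprime_sym (coprime_dvdl pdH coHX).
  have /semipermutableP[_ permX] := semi_in_M X sXM.
  by rewrite permX // coprime_sym.
have /sub_M-/(_ sHG) sHM: coprime #|H| #|G : M|.
  by rewrite coprime_sym prime_coprime.
by have /semipermutableP[_ permH] := semi_in_M H sHM; apply: permH.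
Qed.

(** * The nilpotent residual *)

(** The residual is the limit of the lower central series, which stabilises
    after at most #|G| steps; in particular it is a group. *)
Lemma nilpotent_residualE G : nilpotent_residual G = 'L_(#|G|.+1)(G).
Proof.
have nsLG: 'L_(#|G|.+1)(G) <| G := lcn_normal _ _.
apply/eqP; rewrite eqEsubset; apply/andP; split.
  apply: (bigcap_inf [group of 'L_(#|G|.+1)(G)]); rewrite /= nsLG /=.
  apply/lcnP; exists #|G|.
  rewrite /quotient -morphim_lcn ?normal_norm //; exact: trivg_quotient.
apply/bigcapsP=> N /andP[nsNG nilGN]; have nNG := normal_norm nsNG.
rewrite -quotient_sub1 ?(subset_trans (lcn_sub _ _)) //.
rewrite /quotient morphim_lcn // subG1; apply/eqP/lcn_nil_classP => //.
apply: leq_trans (leq_quotient N G).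
by apply: ltnW; rewrite -nilpotent_class.
Qed.

Lemma nilpotent_residual_normal G : nilpotent_residual G <| G.
Proof. by rewrite nilpotent_residualE lcn_normal. Qed.

Lemma nilpotent_residual_quotient G : nilpotent (G / nilpotent_residual G).
Proof.
rewrite nilpotent_residualE; apply/lcnP; exists #|G|.
rewrite /quotient -morphim_lcn ?lcn_norm //; exact: trivg_quotient.
Qed.

Lemma nilpotent_residual_min G N :
  N <| G -> nilpotent (G / N) -> nilpotent_residual G \subset N.
Proof. by move=> nsNG nilGN; apply: (bigcap_inf N); rewrite nsNG. Qed.

(** In K = P Q the group P is a Hall subgroup, and the intersection of K with
    the residual lies in P since its order is prime to #|Q|. The quotient of K
    by this intersection is nilpotent, so the Hall subgroup P is normal. *)
Lemma residual_coprime_norm G P Q :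
    P \subset G -> Q \subset G -> P * Q = Q * P -> coprime #|P| #|Q| ->
    coprime #|nilpotent_residual G| #|Q| ->
  Q \subset 'N(P).
Proof.
move=> sPG sQG cPQ coPQ; have nilGL := nilpotent_residual_quotient G.
have nsLG := nilpotent_residual_normal G.
have [L defL]: exists L, nilpotent_residual G = L.
  by exists [group of 'L_(#|G|.+1)(G)]; apply: nilpotent_residualE.
rewrite {}defL in nsLG nilGL * => coLQ.
have nLK := subset_trans _ (normal_norm nsLG).
have defK: P <*> Q = P * Q by apply: comm_joingE.
have sKG: P <*> Q \subset G by rewrite join_subG sPG.
have oK: #|P <*> Q| = (#|P| * #|Q|)%N by rewrite defK coprime_cardMg.
have hallP: \pi(P).-Hall(P <*> Q) P.
  rewrite /pHall joing_subl pgroup_pi -divgS ?joing_subl // oK mulKn //=.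
  by rewrite -coprime_pi'.
pose N := (L :&: (P <*> Q))%G.
have nsNK: N <| P <*> Q.
  by rewrite /= setIC; apply: normalGI sKG nsLG.
have piN: \pi(P).-group N.
  apply: pnat_dvd (pgroup_pi P); rewrite -(@Gauss_dvdl _ _ #|Q|).
    by rewrite -oK cardSg ?subsetIr.
  exact: coprime_dvdl (cardSg (subsetIl _ _)) coLQ.
have sNP: N \subset P.
  by apply: subset_trans (pcore_sub_Hall hallP); apply: pcore_max.
have nilKN: nilpotent ((P <*> Q) / N).
  rewrite (isog_nil (second_isog (nLK _ sKG))).
  exact: nilpotentS (quotientS _ sKG) nilGL.
have nsNP: N <| P by apply: normalS nsNK; rewrite ?joing_subl.
have hallPN: \pi(P).-Hall((P <*> Q) / N) (P / N).
  by apply: quotient_pHall; rewrite ?normal_norm.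
have: P / N <| (P <*> Q) / N.
  by rewrite (nilpotent_Hall_pcore nilKN hallPN) pcore_normal.
rewrite -cosetpre_normal !quotientGK // => /normal_norm.
by apply: subset_trans; apply: joing_subr.
Qed.

(** Otherwise, with C = 'C_G('F(G)) and D the intersection of C and 'F(G), the
    solvable group C / D is nontrivial and has a nontrivial Fitting subgroup
    A / D. As D is central in C, the normal subgroup A of G is nilpotent, so A
    lies in 'F(G) and hence in D. *)
Lemma sol_cent_Fitting G : solvable G -> 'C_G('F(G)) \subset 'F(G).
Proof.
move=> solG; pose C := 'C_G('F(G))%G; pose D := (C :&: 'F(G))%G.
have nsFG: 'F(G) <| G := Fitting_normal G.
have nsCG: C <| G by apply/norm_normalI/norms_cent/normal_norm.
have nsDG: D <| G by apply: normalI.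
have sDC: D \subset C := subsetIl _ _.
have nsDC: D <| C := normalS sDC (normal_sub nsCG) nsDG.
pose A := (coset D @*^-1 'F(C / D))%G.
have nsDA: D <| A by rewrite normal_cosetpre.
have defAD: A / D = 'F(C / D) by rewrite cosetpreK.
have nsAG: A <| G.
  rewrite -(quotientGK nsDG) cosetpre_normal.
  by rewrite gFnormal_trans ?quotient_normal.
have sAC: A \subset C.
  have: A \subset coset D @*^-1 (C / D) by rewrite morphpreS ?Fitting_sub.
  by rewrite (quotientGK nsDC).
have sDZ: D \subset 'Z(A).
  rewrite subsetI normal_sub //= centsC.
  apply: subset_trans sAC _; apply: subset_trans (subsetIr _ _) _.
  exact/centS/subsetIr.
have nilA: nilpotent A.
  have nsZA := center_normal A.
  rewrite -quotient_center_nil -(isog_nil (third_isog sDZ nsDA nsZA)).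
  apply: quotient_nil.
  by rewrite [nilpotent _](congr1 nilpotent defAD) Fitting_nil.
have sAD: A \subset D by rewrite subsetI sAC Fitting_max.
have: 'F(C / D) == 1 by rewrite -defAD -subG1 quotient_sub1 ?normal_norm.
rewrite trivg_Fitting ?quotient_sol ?(solvableS (normal_sub nsCG)) //.
by rewrite -subG1 quotient_sub1 ?normal_norm // subsetI => /andP[].
Qed.

End OneGroup.

(** * Coprime actions in groups where coprime subgroups permute *)

Section Commuting.

Variable gT : finGroupType.
Implicit Types G H K L M N P Q X : {group gT}.

(** For a solvable group K this contains Burnside's normal complement theorem:
    if N_Q(P) centralises the abelian Sylow subgroup P then the p-complement Q
    is normal in P Q. With C = 'O_p^'(K), the Fitting subgroup of K / C is a
    p-group, so it lies in the abelian Sylow subgroup P / C, which centralises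
    it and hence equals it; thus C P is normal in K. The Frattini argument
    yields Q = C 'N_Q(P), and P normalises both C and the subgroup 'N_Q(P),
    which it centralises. *)
Lemma abelian_Sylow_complement_norm (p : nat) K P Q :
    solvable K -> P * Q = K -> p.-group P -> p^'.-group Q -> abelian P ->
    'N_Q(P) \subset 'C(P) ->
  P \subset 'N(Q).
Proof.
move=> solK defK pP p'Q abP cPNQ.
have sPK: P \subset K by rewrite -defK mulG_subl.
have sQK: Q \subset K by rewrite -defK mulG_subr.
have oK: #|K| = (#|P| * #|Q|)%N.
  by rewrite -defK coprime_cardMg // (pnat_coprime pP).
have sylP: p.-Sylow(K) P.
  by rewrite /pHall sPK pP -divgS // oK mulKn.
have hallQ: p^'.-Hall(K) Q.
  by rewrite /pHall sQK p'Q -divgS // oK mulnK // pnatNK.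
pose C := 'O_p^'(K)%G; have nsCK: C <| K := pcore_normal _ _.
have nCK := normal_norm nsCK; have nCP := subset_trans sPK nCK.
have sCQ: C \subset Q := pcore_sub_Hall hallQ.
have sylPC: p.-Sylow(K / C) (P / C) by apply: quotient_pHall.
have nsPC: P / C <| K / C.
  have FKC: 'F(K / C) = 'O_p(K / C).
    exact/Fitting_eq_pcore/trivg_pcore_quotient.
  have sFP := pcore_sub_Hall sylPC; rewrite -FKC in sFP.
  suff ->: P / C = 'F(K / C) by rewrite gFnormal.
  apply/eqP; rewrite eqEsubset sFP andbT.
  apply: subset_trans (sol_cent_Fitting (quotient_sol _ solK)).
  rewrite subsetI quotientS //=; apply: subset_trans (centS sFP).
  exact: quotient_abelian.
have nsRK: C <*> P <| K.
  move: nsPC; rewrite -cosetpre_normal quotientK // quotientGK //.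
  by rewrite norm_joinEr.
have sylPR: p.-Sylow(C <*> P) P.
  exact: pHall_subl (joing_subr _ _) (normal_sub nsRK) sylP.
have defKN := Frattini_arg nsRK sylPR.
have defQ: Q = C * 'N_Q(P) :> {set gT}.
  apply/eqP; rewrite eqEsubset mul_subG ?subsetIl ?andbT //.
  have defCN: C * 'N_K(P) = K.
    rewrite -[RHS]defKN /= norm_joinEr // -mulgA; congr (_ * _).
    by rewrite mulSGid // subsetI sPK normG.
  have sQCN: Q \subset C * 'N_K(P) :&: Q by rewrite defCN subsetI sQK /=.
  apply: subset_trans sQCN _; rewrite -group_modl // mulgS //.
  by rewrite setIC setIS ?subsetIr.
by rewrite defQ normsM // cents_norm // centsC.
Qed.

(** If no p'-element acts nontrivially on a cyclic p-subgroup, then a Hall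
    p'-subgroup H of G is normalised by each p-element x: for y in H the group
    <[x]> <*> <[y]> has a normal p-complement, namely <[y]>. Thus H is normal
    with a p-group as quotient, and contains the residual. *)
Lemma residual_p'group (p : nat) G :
    solvable G -> coprime_permuting G ->
    (forall x y, x \in G -> y \in G -> p.-elt x -> p^'.-elt y ->
       y \in 'N(<[x]>) -> commute x y) ->
  p^'.-group (nilpotent_residual G).
Proof.
move=> solG cpG cent_pG.
have norm_p'elt x y: x \in G -> y \in G -> p.-elt x -> p^'.-elt y ->
  x \in 'N(<[y]>).
- move=> Gx Gy px p'y.
  have sxG: <[x]> \subset G by rewrite cycle_subG.
  have syG: <[y]> \subset G by rewrite cycle_subG.
  have cxy: <[x]> * <[y]> = <[y]> * <[x]>.
    by apply: cpG; rewrite // (pnat_coprime px).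
  rewrite -cycle_subG.
  apply: (@abelian_Sylow_complement_norm p (<[x]> <*> <[y]>)) => //.
  - by rewrite (solvableS _ solG) // join_subG sxG.
  - by rewrite /= comm_joingE.
  - exact: cycle_abelian.
  rewrite centsC cycle_subG; apply/centP=> z /setIP[yz nxz].
  apply: cent_pG => //; first exact: (subsetP syG).
  exact: mem_p_elt yz.
have [H hallH] := Hall_exists p^' solG; have [P sylP] := Sylow_exists p G.
have [sHG p'H _] := and3P hallH; have [sPG pP _] := and3P sylP.
have nHP: P \subset 'N(H).
  apply/subsetP=> x Px; rewrite inE; apply/subsetP=> _ /imsetP[y Hy ->].
  have: <[y]> \subset H by rewrite cycle_subG.
  move/subsetP; apply; rewrite memJ_norm ?cycle_id //.
  apply: norm_p'elt; first exact: (subsetP sPG).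
  - exact: (subsetP sHG).
  - exact: mem_p_elt Px.
  - exact: mem_p_elt Hy.
have defG: H * P = G.
  apply/eqP; rewrite eqEcard mul_subG //= coprime_cardMg; last first.
    by rewrite coprime_sym (pnat_coprime pP).
  by rewrite (card_Hall hallH) (card_Hall sylP) mulnC partnC.
have nsHG: H <| G by rewrite /normal sHG -defG mul_subG ?normG.
apply: pgroupS p'H; apply: nilpotent_residual_min => //.
by rewrite -defG quotientMidl (pgroup_nil (quotient_pgroup H pP)).
Qed.

(** A p'-element y acting trivially on a cyclic p-group <[x]> modulo the p-th
    powers centralises it. Indeed y centralises the subgroup of order p of
    <[x]>, which lies in every nontrivial subgroup of <[x]>, whereas no
    nontrivial element of [~: <[x]>, <[y]>] is centralised by y. *)
Lemma coprime_cyclic_Frattini_cent (p : nat) (x y : gT) a :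
    prime p -> p.-elt x -> p^'.-elt y -> x ^ y = x ^+ (p * a).+1 ->
  commute x y.
Proof.
move=> p_pr px p'y def_xy.
have nxy: <[y]> \subset 'N(<[x]>).
  by rewrite cycle_subG inE -cycleJ cycle_subG def_xy mem_cycle.
have TI: 'C_[~: <[x]>, <[y]>](<[y]>) = 1.
  by apply: coprime_abel_cent_TI; rewrite ?cycle_abelian ?(pnat_coprime px).
have sDx: [~: <[x]>, <[y]>] \subset <[x]> by rewrite commg_subl.
suff /commG1P: [~: <[x]>, <[y]>] = 1.
  move/centsP; apply; exact: cycle_id.
have [x1 | ntx] := eqVneq x 1.
  by apply/trivgP; apply: subset_trans sDx _; rewrite x1 cycle1.
have [e ox] : exists e, #[x] = (p ^ e.+1)%N.
  have [[|e] ox] := p_natP px; last by exists e.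
  by case/eqP: ntx; apply/eqP; rewrite -order_eq1 ox.
pose z := x ^+ (p ^ e); have oz: #[z] = p.
  by rewrite orderXdiv ox ?dvdn_exp2l // expnS mulnK // expn_gt0 prime_gt0.
apply/eqP; apply/idPn => ntD.
have zD: <[z]> \subset [~: <[x]>, <[y]>].
  rewrite -(cardSg_cyclic (cycle_cyclic x)) ?cycleX //.
  rewrite [#|<[z]>|]oz; have pD: p.-group [~: <[x]>, <[y]>] := pgroupS sDx px.
  by have [] := pgroup_pdiv pD ntD.
have cz: z \in 'C(<[y]>).
  rewrite cent_cycle; apply/cent1P/commgP/conjg_fixP.
  rewrite /z conjXg def_xy -expgM mulSn expgD.
  have /eqP->: x ^+ (p * a * p ^ e) == 1; last by rewrite mulg1.
  by rewrite -order_dvdn ox mulnAC -expnS dvdn_mulr.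
have: z \in 'C_[~: <[x]>, <[y]>](<[y]>) by rewrite inE cz -cycle_subG zD.
by rewrite TI => /set1P z1; move: (prime_gt1 p_pr); rewrite -oz z1 order1.
Qed.

(** H is generated by its elements of prime power order, and the elements h
    of H with h X included in X H are closed under products. *)
Lemma mulGC_primary H X :
    (forall (p : nat) h, h \in H -> p.-elt h -> <[h]> * X = X * <[h]>) ->
  H * X = X * H.
Proof.
move=> permX; apply/eqP.
have oHX: #|H * X| = #|X * H| by rewrite -[RHS]card_invg invMG.
rewrite eqEcard oHX leqnn andbT; apply/subsetP=> _ /mulsgP[h x Hh Xx ->].
pose S (k : gT) := k \in H /\ forall t, t \in X -> k * t \in X * H.
suff [_ /(_ x Xx)]: S h by [].
rewrite -(prod_constt h); apply: big_ind => [|k l [Hk Sk] [Hl Sl]|p _].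
- by split=> // t Xt; rewrite mul1g -(mulg1 t) mem_mulg.
- split=> [|t Xt]; first exact: groupM.
  have /mulsgP[t1 l1 Xt1 Hl1 def_lt] := Sl t Xt.
  have /mulsgP[t2 k2 Xt2 Hk2 def_kt] := Sk t1 Xt1.
  by rewrite -mulgA def_lt mulgA def_kt -mulgA mem_mulg ?groupM.
have Hhp: h.`_p \in H by apply: groupX.
split=> // t Xt; have: h.`_p * t \in <[h.`_p]> * X.
  by rewrite mem_mulg ?cycle_id.
rewrite (permX p) ?p_elt_constt //; apply/subsetP/mulgS.
by rewrite cycle_subG.
Qed.

Lemma coprime_permuting_primary G :
    (forall (p q : nat) x y, x \in G -> y \in G -> p.-elt x -> q.-elt y ->
       coprime #[x] #[y] -> <[x]> * <[y]> = <[y]> * <[x]>) ->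
  coprime_permuting G.
Proof.
move=> permG H X sHG sXG coHX; apply: mulGC_primary => p x Hx px.
apply/esym/mulGC_primary => q y Xy qy; apply/esym/(permG p q) => //.
- exact: (subsetP sHG).
- exact: (subsetP sXG).
exact: coprime_dvdl (order_dvdG Hx) (coprime_dvdr (order_dvdG Xy) coHX).
Qed.

End Commuting.

(** * Direct products *)

Section Product.

Variables (I : finType) (gT : I -> finGroupType).
Variable G : forall i : I, {group gT i}.
Implicit Types (u v : {dffun forall i, gT i}) (i j : I).

Lemma expg_ffun i u k : (u ^+ k) i = u i ^+ k.
Proof. by elim: k => [|k IHk]; rewrite ?oneg_ffun // !expgS mulg_ffun IHk. Qed.

Lemma order_ffun_dvd i u : #[u i] %| #[u].
Proof. by rewrite order_dvdn -expg_ffun expg_order oneg_ffun. Qed.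

Lemma dfung1_in i x : x \in G i -> dfung1 x \in setXn G.
Proof.
move=> Gx; apply/setXnP=> j; have [<-|ij] := eqVneq i j.
  by rewrite dfung1_id.
by rewrite dfung1_dflt.
Qed.

Lemma dfung1X i (x : gT i) k : dfung1 (x ^+ k) = dfung1 x ^+ k.
Proof. exact: (morphX (dfung1_morphism gT i) k (in_setT x)). Qed.

Lemma eq_dfung1 i u : (forall j, j != i -> u j = 1) -> u = dfung1 (u i).
Proof.
move=> u1; apply/ffunP=> j; have [<-|ij] := eqVneq i j.
  by rewrite dfung1_id.
by rewrite dfung1_dflt // u1 // eq_sym.
Qed.

Lemma dfung1_conjg i (x : gT i) v : dfung1 x ^ v = dfung1 (x ^ v i).
Proof.
apply/ffunP=> j; rewrite !mulg_ffun invg_ffun; have [<-|ij] := eqVneq i j.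
  by rewrite !dfung1_id.
by rewrite !dfung1_dflt // mul1g mulVg.
Qed.

Lemma cycle_dfung1 i (x : gT i) : <[dfung1 x]> = dfung1_morphism gT i @* <[x]>.
Proof. by rewrite morphim_cycle ?inE. Qed.

Lemma dfung1_norm_cycle i (x : gT i) v :
  v i \in 'N(<[x]>) -> v \in 'N(<[dfung1 x]>).
Proof.
move=> nxv; rewrite inE -cycleJ cycle_subG dfung1_conjg.
have: x ^ v i \in <[x]> by rewrite memJ_norm ?cycle_id.
by case/cycleP=> k ->; rewrite dfung1X mem_cycle.
Qed.

Lemma setXn_factor_coprime_permuting i :
  coprime_permuting (setXn G) -> coprime_permuting (G i).
Proof.
move=> cpG H X sHG sXG coHX; pose f := dfung1_morphism gT i.
have injf: 'injm f := injm_dfung1 gT i.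
have sub_prod (A : {group gT i}) : A \subset G i -> f @* A \subset setXn G.
  move=> sAG; apply/subsetP=> _ /morphimP[x _ Ax ->].
  exact/dfung1_in/(subsetP sAG).
apply: (injm_morphim_inj injf); rewrite ?subsetT //.
rewrite !morphimMl ?subsetT //; apply: cpG; rewrite ?sub_prod //.
by rewrite !card_injm ?subsetT.
Qed.

(** If m is not prime to the order of the component u_i of a p-element u, then
    p divides m, so u has no p-part, hence trivial component, in the factors of
    order prime to m. *)
Lemma p_elt_factor_eq1 (p : nat) m i j u :
    p.-elt u -> u \in setXn G -> ~~ coprime m #[u i] -> coprime m #|G j| ->
  u j = 1.
Proof.
move=> pu Gu nco coG; apply/eqP; rewrite -order_eq1; apply: contraR nco => uj1.
have pn k : #[u k] %| #[u] := order_ffun_dvd k u.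
have puk k : p.-nat #[u k] := pnat_dvd (pn k) pu.
have puj : pdiv #[u j] = p.
  have pr : prime (pdiv #[u j]).
    by apply: pdiv_prime; rewrite ltn_neqAle eq_sym uj1 order_gt0.
  by have := pnatP _ (order_gt0 _) (puk j) _ pr (pdiv_dvd _) => /eqP.
have p_m: coprime m p.
  apply: coprime_dvdr coG; rewrite -puj; apply: dvdn_trans (pdiv_dvd _) _.
  by apply: order_dvdG; apply: (setXnP Gu).
have /p_natP[k ->] := puk i.
exact: coprimeXr.
Qed.

Lemma setXn_coprime_permuting :
    (forall i, coprime_permuting (G i)) ->
    (forall i j, i != j -> coprime #|nilpotent_residual (G i)| #|G j|) ->
  coprime_permuting (setXn G).
Proof.
move=> cpG coG; apply: coprime_permuting_primary => p q u v Gu Gv pu qv couv.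
have Gui k : u k \in G k by apply: (setXnP Gu).
have Gvi k : v k \in G k by apply: (setXnP Gv).
have suG k : <[u k]> \subset G k by rewrite cycle_subG.
have svG k : <[v k]> \subset G k by rewrite cycle_subG.
have couvi k : coprime #[u k] #[v k].
  apply: coprime_dvdl (order_ffun_dvd k u) _.
  exact: coprime_dvdr (order_ffun_dvd k v) couv.
have covui k : coprime #[v k] #[u k] by rewrite coprime_sym.
have cuvi k : <[u k]> * <[v k]> = <[v k]> * <[u k]>.
  exact: cpG (suG k) (svG k) (couvi k).
have [/forallP cuv | /forallPn[i ncuv]] :=
  boolP [forall k, u k * v k == v k * u k].
  apply: normC; rewrite cycle_subG; apply: (subsetP (cent_sub _)).
  rewrite cent_cycle; apply/cent1P/ffunP=> k; rewrite !mulg_ffun.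
  by rewrite (eqP (cuv k)).
set m := #|nilpotent_residual (G i)|.
have supp_i w (r : nat) : r.-elt w -> w \in setXn G -> ~~ coprime m #[w i] ->
  w = dfung1 (w i).
- move=> rw Gw nco; apply: eq_dfung1 => j ji.
  by apply: (p_elt_factor_eq1 rw Gw nco); apply: coG; rewrite eq_sym.
have [cov | ncov] := boolP (coprime m #[v i]).
  have nuv: <[v i]> \subset 'N(<[u i]>).
    exact: residual_coprime_norm (suG i) (svG i) (cuvi i) (couvi i) cov.
  have [cou | ncou] := boolP (coprime m #[u i]).
    (* The two cyclic groups would normalise each other, hence commute. *)
    have nvu: <[u i]> \subset 'N(<[v i]>).
      apply: residual_coprime_norm (svG i) (suG i) _ (covui i) cou.
      exact/esym/cuvi.
    case/eqP: ncuv; apply/commgP/eqP/set1gP; rewrite -(coprime_TIg (couvi i)).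
    apply: subsetP (mem_commg (cycle_id _) (cycle_id _)).
    by rewrite commg_subI // subsetI subxx.
  rewrite (supp_i u p) //; apply: esym; apply: normC.
  by rewrite cycle_subG dfung1_norm_cycle // -cycle_subG.
have [cou | ncou] := boolP (coprime m #[u i]).
  have nvu: <[u i]> \subset 'N(<[v i]>).
    apply: residual_coprime_norm (svG i) (suG i) _ (covui i) cou.
    exact/esym/cuvi.
  rewrite (supp_i v q) //; apply: normC.
  by rewrite cycle_subG dfung1_norm_cycle // -cycle_subG.
rewrite (supp_i u p) // (supp_i v q) // !cycle_dfung1.
by rewrite -!morphimMl ?subsetT // cuvi.
Qed.

Lemma setXn_coprime_residual i j :
    coprime_permuting (setXn G) -> solvable (G i) -> i != j ->
  coprime #|nilpotent_residual (G i)| #|G j|.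
Proof.
move=> cpX solG ij; have cpG := setXn_factor_coprime_permuting (i := i) cpX.
rewrite coprime_sym coprime_pi' ?cardG_gt0 //; apply/pgroupP => p p_pr pL.
apply/negP=> /= piGp.
have p_dv_G : p %| #|G j| by move: piGp; rewrite mem_primes => /and3P[].
have [z Gz oz] := Cauchy p_pr p_dv_G.
suff: p^'.-group (nilpotent_residual (G i)).
  by rewrite /pgroup p'natE // pL.
apply: residual_p'group => // x y Gx Gy px p'y nxy.
pose u := dfung1 x * dfung1 z; pose v := dfung1 y.
have uj : u j = z by rewrite mulg_ffun dfung1_id dfung1_dflt // mul1g.
have ui : u i = x by rewrite mulg_ffun dfung1_id dfung1_dflt ?mulg1 // eq_sym.
have uk k : k != i -> k != j -> u k = 1.
  by move=> ki kj; rewrite mulg_ffun !dfung1_dflt ?mulg1 // eq_sym.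
have vi : v i = y by rewrite dfung1_id.
have vj : v j = 1 by rewrite dfung1_dflt.
have Gu : u \in setXn G by rewrite groupM ?dfung1_in.
have Gv : v \in setXn G by rewrite dfung1_in.
clearbody u; have pu : p.-elt u.
  have: #[u] %| #[x] * p.
    rewrite order_dvdn; apply/eqP/ffunP=> k; rewrite expg_ffun oneg_ffun.
    have [->|ki] := eqVneq k i; first by rewrite ui expgM expg_order expg1n.
    have [->|kj] := eqVneq k j; last by rewrite uk // expg1n.
    by rewrite uj mulnC expgM -oz expg_order expg1n.
  by move/pnat_dvd; apply; rewrite pnatM pnat_id ?andbT.
have p'v : p^'.-elt v.
  apply: pnat_dvd p'y; rewrite order_dvdn -dfung1X expg_order.
  apply/eqP/ffunP=> k; rewrite oneg_ffun.
  by have [<-|ik] := eqVneq i k; rewrite ?dfung1_id ?dfung1_dflt.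
have : v * u \in <[u]> * <[v]>.
  rewrite (cpX <[u]>%G <[v]>%G) ?cycle_subG ?mem_mulg ?cycle_id //.
  exact: pnat_coprime pu p'v.
case/mulsgP=> _ _ /cycleP[a ->] /cycleP[b ->] def_vu.
have a1 : a = 1 %[mod p].
  apply/eqP; rewrite -oz -eq_expg_mod_order expg1 -{2}uj.
  have /ffunP/(_ j) := def_vu; rewrite !(mulg_ffun, expg_ffun) uj vj.
  by rewrite mul1g expg1n mulg1 => <-.
have def_yx : y * x = x ^+ a * y ^+ b.
  by have /ffunP/(_ i) := def_vu; rewrite !(mulg_ffun, expg_ffun) ui vi.
have nxV : y^-1 \in 'N(<[x]>) by rewrite groupV.
have Xc : x ^ y^-1 \in <[x]> by rewrite memJ_norm ?cycle_id.
have TI : <[x]> :&: <[y]> = 1 by apply/coprime_TIg/(pnat_coprime px).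
(* x ^ y^-1 * y = x ^+ a * y ^+ b, and the decomposition is unique. *)
have def_c : x ^ y^-1 = x ^+ a.
  have eq_cb : (x ^+ a)^-1 * x ^ y^-1 = y ^+ b * y^-1.
    by rewrite conjgE invgK !mulgA -(mulgA _ y x) def_yx mulKg.
  apply/esym/eqP; rewrite eq_mulVg1; apply/eqP/set1gP; rewrite -TI inE.
  rewrite groupM ?groupV ?mem_cycle //= eq_cb.
  by rewrite groupM ?groupV ?mem_cycle ?cycle_id.
have ea : a = (p * (a %/ p)).+1.
  by rewrite {1}(divn_eq a p) a1 modn_small ?prime_gt1 // mulnC addn1.
have cxyV : commute x y^-1.
  apply: (coprime_cyclic_Frattini_cent p_pr px _ (a := a %/ p)).
    by rewrite p_eltV.
  by rewrite -ea.
by rewrite -[y]invgK; apply: commuteV.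
Qed.

End Product.

Theorem theorem1p14 (n : nat) (hn : 2 <= n)
    (gT : 'I_n -> finGroupType) (G : forall i : 'I_n, {group gT i}) :
  (solvable (setXn G) /\ BT_group (setXn G)) <->
  ((forall i : 'I_n, solvable (G i) /\ BT_group (G i)) /\
   (forall i j : 'I_n, i != j ->
      coprime #|nilpotent_residual (G i)| #|G j|)).
Proof.
split=> [[solX btX] | [solbtG coG]].
  have cpX := sol_BT_coprime_permuting solX btX.
  have solG i : solvable (G i).
    by rewrite -(morphim_dffunXn i G) morphim_sol.
  split=> [i | i j ij]; last exact: setXn_coprime_residual.
  split=> //; apply: coprime_permuting_BT.
  exact: setXn_factor_coprime_permuting.
split; first by apply: setXn_sol => i; have [] := solbtG i.
apply: (@coprime_permuting_BT _ (setXn_group G)).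
apply: setXn_coprime_permuting => // i; have [solGi btGi] := solbtG i.
exact: sol_BT_coprime_permuting.
Qed.
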